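(* Let $\mathbb{T}$ be a time scale, let $a,b\in\mathbb{T}$ with $a<b$, let $I\subset\mathbb{R}$ be an interval, and let $F:I\to\mathbb{R}$ be a continuous convex function on $I$. Let $y,p:[a,b]_{\mathbb{T}}\to I$ be rd-continuous with $p$ nonnegative on $[a,b]_{\mathbb{T}}$, and let $g:[a,b]_{\mathbb{T}}\to I$ be non-decreasing on $[a,b]_{\mathbb{T}}$ with $A=\int_a^b p(t)\,\Delta g(t)>0$. Let $\varphi\in\partial F$ and suppose that the Riemann--Stieltjes $\Delta$-integrals $\int_a^b p(t)y(t)\varphi(y(t))\,\Delta g(t)$ and $\int_a^b p(t)\varphi(y(t))\,\Delta g(t)$ exist, and that $\frac1A\int_a^b p(t)y(t)\,\Delta g(t)\in I$ (so that the value of $F$ there is defined). Then $$0\leq \frac1A\int_a^b p(t)F(y(t))\,\Delta g(t)-F\left(\frac1A\int_a^b p(t)y(t)\,\Delta g(t)\right)$$ and $$\frac1A\int_a^b p(t)F(y(t))\,\Delta g(t)-F\left(\frac1A\int_a^b p(t)y(t)\,\Delta g(t)\right)\leq\frac1A\left(\int_a^b p(t)y(t)\varphi(y(t))\,\Delta g(t)-\frac1A\int_a^b p(t)y(t)\,\Delta g(t)\cdot\int_a^b p(t)\varphi(y(t))\,\Delta g(t)\right).$$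
   Context: A time scale $\mathbb{T}$ is a nonempty closed subset of $\mathbb{R}$, and $[a,b]_{\mathbb{T}}:=[a,b]\cap\mathbb{T}$, $[a,b)_{\mathbb{T}}:=[a,b)\cap\mathbb{T}$. A function on a time scale is rd-continuous if it is continuous at every right-dense point and has finite left-sided limits at every left-dense point. For a convex function $F:I\to\mathbb{R}$, the subdifferential $\partial F$ is the set of all functions $\varphi:I\to\mathbb{R}\cup\{\pm\infty\}$ such that $\varphi(\mathrm{int}(I))\subset\mathbb{R}$ and $F(x)\geq F(y)+(x-y)\varphi(y)$ for all $x,y\in I$ (with the convention $0\cdot(\pm\infty)=0$). Riemann--Stieltjes $\Delta$-integral: let $f,g$ be bounded real-valued functions on $[a,b]_{\mathbb{T}}$ with $g$ non-decreasing on $[a,b]_{\mathbb{T}}$. A partition of $[a,b]_{\mathbb{T}}$ is a finite set $P=\{t_0,\dots,t_n\}\subset[a,b]_{\mathbb{T}}$ with $a=t_0<t_1<\dots<t_n=b$; a partition $P\supset P^*$ is called a refinement of $P^*$. For a selection $X=\{x_1,\dots,x_n\}$ with $x_i\in[t_{i-1},t_i)_{\mathbb{T}}$ put $S_g(f,P,X)=\sum_{i=1}^n f(x_i)(g(t_i)-g(t_{i-1}))$. Then $f$ is Riemann--Stieltjes $\Delta$-integrable with respect to $g$ on $[a,b]_{\mathbb{T}}$ if there is a number $\mathcal{I}\in\mathbb{R}$ such that for every $\varepsilon>0$ there is a partition $P^*$ with $|S_g(f,P,X)-\mathcal{I}|<\varepsilon$ for all refinements $P\supset P^*$ and all selections $X$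 for $P$; this (unique) number is denoted $\int_a^b f(t)\,\Delta g(t)=\mathcal{I}$. Existence of an integral includes that its integrand is a bounded real-valued function on $[a,b]_{\mathbb{T}}$. *)

(* Defs.v *)
(* MathComp-Analysis; the reals are an arbitrary [R : realType]. *)
From mathcomp Require Import all_boot all_order all_algebra.
From mathcomp Require Import all_classical all_reals all_analysis.

Set Implicit Arguments.
Unset Strict Implicit.
Unset Printing Implicit Defensive.

Import Order.TTheory GRing.Theory Num.Theory.
Import numFieldNormedType.Exports.

Local Open Scope classical_set_scope.
Local Open Scope ring_scope.

(* A function on a subset of R is encoded as a total function on R of which
   only the values on that subset are ever used. *)

Section TimeScale.
Context {R : realType}.
Implicit Types (T : set R) (t a b : R) (f : R -> R).

Definition time_scale T : Prop := T !=set0 /\ closed T.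

Definition ts_cc T a b : set R := [set t | T t /\ a <= t <= b].

Definition ts_co T a b : set R := [set t | T t /\ a <= t < b].

(* The jump operators sigma and rho; only meaningful when the set under
   [inf] (resp. [sup]) is nonempty, which the two density notions demand. *)
Definition forward_jump T t : R := inf [set s | T s /\ t < s].
Definition backward_jump T t : R := sup [set s | T s /\ s < t].

Definition right_dense T t : Prop :=
  [/\ T t, exists2 s, T s & t < s & forward_jump T t = t].

Definition left_dense T t : Prop :=
  [/\ T t, exists2 s, T s & s < t & backward_jump T t = t].

(* Continuity and left-sided limits are those of the restriction of [f] to T. *)
Definition rd_continuous T f : Prop :=
  (forall t, right_dense T t -> f @ within T (nbhs t) --> f t) /\
  (forall t, left_dense T t -> exists l : R, f @ within T (t^'-) --> l).

End TimeScale.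

Section Subdifferential.
Context {R : realType}.

(* In [\bar R], 0 * +oo = 0 * -oo = 0. *)
Definition subdifferential (I : interval R) (F : R -> R) : set (R -> \bar R) :=
  [set phi | (forall y, interior [set` I] y -> phi y \is a fin_num) /\
    (forall x y, x \in I -> y \in I ->
       ((F y)%:E + (x - y)%:E * phi y <= (F x)%:E)%E)].

End Subdifferential.

Section RiemannStieltjesDelta.
Context {R : realType}.
Implicit Types (T : set R) (a b : R) (f g : R -> R) (s : seq R) (X : nat -> R).

(* The partition {t_0 < ... < t_n} is encoded by the list [s] of t_1, ..., t_n;
   t_0 = a, and [itv_partition] makes [a :: s] increasing with last point b. *)
Definition ts_partition T a b s : Prop :=
  itv_partition a b s /\ {in a :: s, forall t, ts_cc T a b t}.

Definition refines a s s0 : Prop := {subset a :: s0 <= a :: s}.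

(* [X i] is x_{i+1}, chosen in [t_i, t_{i+1})_T. *)
Definition selection T a b s X : Prop :=
  forall i, (i < size s)%N ->
    ts_co T (nth b (a :: s) i) (nth b (a :: s) i.+1) (X i).

Definition RS_sum a b g f s X : R :=
  \sum_(0 <= i < size s)
    f (X i) * (g (nth b (a :: s) i.+1) - g (nth b (a :: s) i)).

Definition is_RS_delta_integral T a b g f (l : R) : Prop :=
  [bounded f t | t in ts_cc T a b] /\
  forall e : R, 0 < e -> exists2 s0, ts_partition T a b s0 &
    forall s, ts_partition T a b s -> refines a s s0 ->
    forall X, selection T a b s X -> `|RS_sum a b g f s X - l| < e.

Definition RS_delta_integrable T a b g f : Prop :=
  exists l, is_RS_delta_integral T a b g f l.

(* Equal to 0 when [f] is not integrable. *)
Definition RS_delta_integral T a b g f : R :=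
  xget 0 (is_RS_delta_integral T a b g f).

(* For an integrand written with extended real values, integrability includes
   that it takes only real values on [a, b]_T. *)
Definition RS_delta_integrable_ext T a b g (h : R -> \bar R) : Prop :=
  (forall t, ts_cc T a b t -> h t \is a fin_num) /\
  RS_delta_integrable T a b g (fine \o h).

Definition RS_delta_integral_ext T a b g (h : R -> \bar R) : R :=
  RS_delta_integral T a b g (fine \o h).

End RiemannStieltjesDelta.

(* Main.v *)
Require Import Defs.
From mathcomp Require Import all_boot all_order all_algebra.
From mathcomp Require Import all_classical all_reals all_analysis.
From mathcomp Require Import ring lra.

Set Implicit Arguments.
Unset Strict Implicit.
Unset Printing Implicit Defensive.

Import Order.TTheory GRing.Theory Num.Theory.
Import numFieldNormedType.Exports.

Local Open Scope classical_set_scope.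
Local Open Scope ring_scope.

(** Write D for [a,b]_T.  Refinement directs the pairs (partition, selection),
    and the Riemann-Stieltjes Delta-integral is the limit of the sums along the
    resulting filter; linearity, monotonicity and the Cauchy criterion for
    integrals are then those of limits along a proper filter.

    Existence of the integrals.  Selections live in half-open intervals, so a
    function is integrable against every non-decreasing [g] as soon as, for each
    e > 0, some partition has oscillation at most e on every [t_i, t_(i+1))_T
    ([small_osc_integrable]).  A supremum argument ([osc_partition]) reduces this
    to a local condition: at each t in D, arbitrarily small oscillation on a left
    neighbourhood without t and on a right neighbourhood with t.  Rd-continuous
    functions satisfy it, and so do their products: this settles [p] and [p * y].

    The delicate integrand is p * F(y): the left limit of [y] at a left-dense
    point may be an endpoint of [I] outside [I], where [F] may blow up.  What
    saves the claim is the existence of the integral of p * phi(y), which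
    contains a bound B on |p * phi(y)|.  The subgradient inequality multiplied
    by [p] says that moving the argument of [F] by d costs at most d * B in
    p * F(y).  If [p] has a nonzero limit, then F(y) is also bounded and the
    oscillation is small; if [p] tends to 0, then p * F(y) tends to 0
    ([weighted_convex_osc]).

    The lower bound is Jensen's inequality.  It is proved for the sums
    ([RS_sum_jensen]) and passed to the limit by continuity of [F] within [I]:
    the usual supporting line at the mean m is not available, since phi(m) may
    be infinite when m is an endpoint of [I].  The upper bound integrates
    F(m) >= F(y) + (m - y) * phi(y), weighted by [p]: where phi(y) is infinite,
    finiteness of p * phi(y) forces p = 0. *)

(** * Riemann-Stieltjes sums *)

Section Sums.
Context {R : realType}.
Implicit Types (T : set R) (a b t : R) (f g : R -> R) (s : seq R) (X : nat -> R).

Lemma mem_le_last a s x : path <%R a s -> x \in a :: s -> x <= last a s.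
Proof.
elim: s a x => [|t s IH] a x /=; first by rewrite inE => _ /eqP->.
case/andP=> at_ ps; rewrite in_cons => /predU1P[->|]; last exact: IH.
by rewrite (le_trans (ltW at_))// IH// mem_head.
Qed.

Lemma RS_sum_nil a b g f X : RS_sum a b g f [::] X = 0.
Proof. by rewrite /RS_sum big_geq. Qed.

Lemma RS_sum_cons a b g f t s X :
  RS_sum a b g f (t :: s) X =
  f (X 0%N) * (g t - g a) + RS_sum t b g f s (X \o S).
Proof. by rewrite /RS_sum big_nat_recl//. Qed.

Lemma RS_sum_cat a b g f s1 s2 X :
  RS_sum a b g f (s1 ++ s2) X =
  RS_sum a b g f s1 X + RS_sum (last a s1) b g f s2 (fun i => X (size s1 + i)%N).
Proof.
elim: s1 a X => [|t s1 IH] a X /=; first by rewrite RS_sum_nil add0r.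
by rewrite !RS_sum_cons IH addrA.
Qed.

Lemma selection_cons T a b t s X : selection T a b (t :: s) X ->
  ts_co T a t (X 0%N) /\ selection T t b s (X \o S).
Proof. by move=> h; split=> [|i si]; [exact: (h 0%N)|exact: (h i.+1)]. Qed.

Lemma selection_cat T a b s1 s2 X : selection T a b (s1 ++ s2) X ->
  selection T a b s1 X /\
  selection T (last a s1) b s2 (fun i => X (size s1 + i)%N).
Proof.
elim: s1 a X => [|t s1 IH] a X //=.
move=> /selection_cons[X0 /IH[h1 h2]]; split=> // -[|i] //; exact: h1.
Qed.

Lemma RS_sum_ge0 T a b g f s X : path <%R a s ->
    path (fun u v => g u <= g v) a s -> selection T a b s X ->
    (forall u, ts_co T a (last a s) u -> 0 <= f u) ->
  0 <= RS_sum a b g f s X.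
Proof.
elim: s a X => [|t s IH] a X; first by rewrite RS_sum_nil.
rewrite RS_sum_cons/=.
move=> /andP[at_ ts] /andP[gat gs] /selection_cons[[TX /andP[aX Xt]] Xs] f0.
have tl : t <= last t s by rewrite mem_le_last// mem_head.
rewrite addr_ge0//.
  by rewrite mulr_ge0 ?subr_ge0// f0//; split=> //; rewrite aX (lt_le_trans Xt).
apply: IH => // u [Tu /andP[tu ul]]; apply: f0.
by split=> //; rewrite (le_trans (ltW at_)).
Qed.

Lemma RS_sum_lin a b g (c d : R) f1 f2 s X :
  RS_sum a b g (fun t => c * f1 t + d * f2 t) s X =
  c * RS_sum a b g f1 s X + d * RS_sum a b g f2 s X.
Proof.
rewrite /RS_sum !mulr_sumr -big_split/=; apply: eq_bigr => i _; ring.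
Qed.

End Sums.

Section Refinement.
Context {R : realType}.
Variables (T : set R) (b : R) (g f : R -> R) (e : R).
Implicit Types (a t : R) (s : seq R) (X : nat -> R).

Definition small_osc x z : Prop :=
  forall u v, ts_co T x z u -> ts_co T x z v -> `|f u - f v| <= e.

(** On an interval where [f] stays within [e] of [c], each term of the sum is
    within [e] times the increment of [g] of the corresponding term for [c]; the
    increments telescope. *)
Lemma RS_sum_near_const a c s X : path <%R a s ->
    path (fun u v => g u <= g v) a s -> selection T a b s X ->
    (forall u, ts_co T a (last a s) u -> `|f u - c| <= e) ->
  `|RS_sum a b g f s X - c * (g (last a s) - g a)| <= e * (g (last a s) - g a).
Proof.
elim: s a X => [|t s IH] a X /=.
  by rewrite RS_sum_nil subrr !mulr0 subrr normr0.
case/andP=> at_ pts /andP[gat gts] /selection_cons[[TX /andP[aX Xt]] Xs] fc.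
have tl : t <= last t s by rewrite mem_le_last// mem_head.
have /ler_normlP[h1 h2] : `|RS_sum t b g f s (X \o S) -
    c * (g (last t s) - g t)| <= e * (g (last t s) - g t).
  apply: IH => // u [Tu /andP[tu ul]]; apply: fc; split=> //.
  by rewrite (le_trans (ltW at_)).
have /ler_normlP[k1 k2] : `|f (X 0%N) - c| <= e.
  by apply: fc; split=> //; rewrite aX (lt_le_trans Xt).
have dg : 0 <= g t - g a by rewrite subr_ge0.
rewrite RS_sum_cons; apply/ler_normlP.
by have := ler_wpM2r dg k1; have := ler_wpM2r dg k2; split; lra.
Qed.

(** The refined partition is cut at the first point of the coarse one; the part
    before the cut is compared with a single constant, and the part after it by
    induction. *)
Lemma RS_sum_refine a s0 s X X0 : path <%R a s0 -> path <%R a s ->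
    {subset s0 <= s} -> last a s = last a s0 ->
    path (fun u v => g u <= g v) a s ->
    path (fun x z => `[< small_osc x z >]) a s0 ->
    selection T a b s X -> selection T a b s0 X0 ->
  `|RS_sum a b g f s X - RS_sum a b g f s0 X0| <= e * (g (last a s) - g a).
Proof.
elim: s0 a s X X0 => [|t s0 IH] a s X X0 /=.
  case: s => [_ _ _ _ _ _ _ _|x s _ ps _ lxs].
    by rewrite !RS_sum_nil/= !subrr mulr0 normr0.
  have := ps => /= /andP[ax px].
  have : x <= last x s by rewrite mem_le_last// mem_head.
  by move: lxs => /= ->; rewrite leNgt ax.
case/andP=> at_ p0 ps sub; have ts : t \in s by rewrite sub// mem_head.
move: ps sub; case/path.splitP: ts => s1 s2; rewrite cat_path last_rcons.
case/andP=> ps1 ps2 sub; rewrite last_cat last_rcons => lst.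
rewrite cat_path last_rcons => /andP[gs1 gs2] /andP[/asboolP osct osc0].
case/selection_cat=> Xs1; rewrite last_rcons => Xs2.
case/selection_cons=> X00 Xs0; rewrite RS_sum_cat last_rcons RS_sum_cons.
have sub' : {subset s0 <= s2}.
  move=> x xs0; have /sub : x \in t :: s0 by rewrite in_cons xs0 orbT.
  rewrite mem_cat => /orP[xs1|//].
  have : x <= last a (rcons s1 t) by rewrite mem_le_last// in_cons xs1 orbT.
  have /allP/(_ _ xs0) : all (> t) s0 by rewrite lt_path_min.
  by rewrite last_rcons /= => /lt_le_trans/[apply]; rewrite ltxx.
have /ler_normlP[h1 h2] := IH _ _ _ _ p0 ps2 sub' lst gs2 osc0 Xs2 Xs0.
have /ler_normlP[k1 k2] : `|RS_sum a b g f (rcons s1 t) X -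
    f (X0 0%N) * (g t - g a)| <= e * (g t - g a).
  have := RS_sum_near_const ps1 gs1 Xs1; rewrite last_rcons; apply=> u ut.
  exact: osct.
by apply/ler_normlP; split; lra.
Qed.

End Refinement.

(** * The integral as a limit along refinements *)

Section RefinementFilter.
Context {R : realType}.
Implicit Types (T : set R) (a b t : R) (f g : R -> R) (s : seq R) (X : nat -> R).

(** Partition and selection are taken together, so that one filter expresses
    both the refinement and the arbitrariness of the selection. *)
Definition RS_filter T a b : set_system (seq R * (nat -> R)) :=
  filter_from [set s0 | ts_partition T a b s0]
    (fun s0 => [set sX | [/\ ts_partition T a b sX.1, refines a sX.1 s0 &
                             selection T a b sX.1 sX.2]]).

Lemma selection_left T a b s :
  ts_partition T a b s -> selection T a b s (nth b (a :: s)).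
Proof.
case=> -[/(pathP b) ps _] Ds i si; split; last by rewrite lexx ps.
by have [] := Ds _ (mem_nth b (leqW si : (i < size (a :: s))%N)).
Qed.

Lemma ts_partition_join T a b s1 s2 : ts_partition T a b s1 ->
  ts_partition T a b s2 ->
  exists s, [/\ ts_partition T a b s, refines a s s1 & refines a s s2].
Proof.
move=> [[ps1 /eqP l1] D1] [[ps2 /eqP l2] D2].
pose s := sort <=%R (undup (s1 ++ s2)).
have sE x : (x \in s) = (x \in s1) || (x \in s2).
  by rewrite mem_sort mem_undup mem_cat.
have sas x : x \in a :: s -> x \in a :: s1 \/ x \in a :: s2.
  rewrite !in_cons sE => /or3P[->|->|->]; rewrite ?orbT; by [left|left|right].
have r1 : refines a s s1.
  by move=> x; rewrite !in_cons sE => /orP[->//|->]; rewrite orbT.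
have r2 : refines a s s2.
  by move=> x; rewrite !in_cons sE => /orP[->//|->]; rewrite !orbT.
have ps : path <%R a s.
  rewrite lt_path_sortedE lt_sorted_uniq_le sort_uniq undup_uniq/=.
  rewrite (sort_sorted (@le_total _ R)) andbT; apply/allP => x.
  by rewrite sE => /orP[xs|xs]; [apply: (allP (lt_path_min ps1))|
                                 apply: (allP (lt_path_min ps2))].
exists s; split=> //; split; last first.
  by move=> x /sas[/D1|/D2].
split=> //; rewrite eq_le; apply/andP; split.
  have /sas[h|h] := mem_last a s.
    by have := mem_le_last ps1 h; rewrite l1.
  by have := mem_le_last ps2 h; rewrite l2.
by apply: mem_le_last => //; apply: r1; rewrite -l1 mem_last.
Qed.

End RefinementFilter.

Section Integral.
Context {R : realType} (T : set R) (a b : R) (g : R -> R).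
Hypotheses (Ta : T a) (Tb : T b) (ab : a < b).
Hypothesis g_nd : forall s t, ts_cc T a b s -> ts_cc T a b t -> s <= t ->
  g s <= g t.

Local Notation D := (ts_cc T a b).
Local Notation RSF := (RS_filter T a b).
Implicit Types (f h : R -> R) (s : seq R) (X : nat -> R).

Lemma ts_cc_left : D a. Proof. by split=> //; rewrite lexx ltW. Qed.
Lemma ts_cc_right : D b. Proof. by split=> //; rewrite lexx ltW. Qed.

Lemma ts_partition1 : ts_partition T a b [:: b].
Proof.
split; first exact: itv_partition1.
move=> x; rewrite !inE => /orP[] /eqP->;
  [exact: ts_cc_left|exact: ts_cc_right].
Qed.

#[local] Instance RS_filter_proper : ProperFilter RSF.
Proof.
apply: filter_from_proper; last first.
  by move=> s Ps; exists (s, nth b (a :: s)); split=> //; exact: selection_left.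
apply: filter_from_filter; first by exists [:: b]; exact: ts_partition1.
move=> s1 s2 P1 P2; have [s [Ps r1 r2]] := ts_partition_join P1 P2.
by exists s => // sX [PsX r sel]; split; split=> // x; [move/r1/r|move/r2/r].
Qed.

Lemma is_RS_delta_integralP f l :
  is_RS_delta_integral T a b g f l <->
  [bounded f t | t in D] /\ RS_sum a b g f sX.1 sX.2 @[sX --> RSF] --> l.
Proof.
split=> -[bf h]; split=> //.
  apply/cvgrPdist_lt => e e0; have [s0 Ps0 hs0] := h _ e0.
  by exists s0 => // -[s X] [Ps rs Xs] /=; rewrite distrC; exact: hs0.
move=> e e0; have /cvgrPdist_lt /(_ _ e0)[s0 Ps0 hs0] := h.
by exists s0 => // s Ps rs X Xs; rewrite distrC; exact: (hs0 (s, X)).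
Qed.

Lemma RS_delta_integral_cvg f : RS_delta_integrable T a b g f ->
  RS_sum a b g f sX.1 sX.2 @[sX --> RSF] --> RS_delta_integral T a b g f.
Proof. by move=> /(xgetPex 0)/is_RS_delta_integralP[]. Qed.

Lemma near_partition : \forall sX \near RSF,
  ts_partition T a b sX.1 /\ selection T a b sX.1 sX.2.
Proof. by exists [:: b]; [exact: ts_partition1|move=> sX []]. Qed.

Lemma ts_partition_monotone s : ts_partition T a b s ->
  path (fun u v => g u <= g v) a s.
Proof.
case=> -[ps _] Ds; apply: (sub_in_path (P := mem (a :: s))) ps.
  by move=> u v us vs /ltW; apply: g_nd; exact: Ds.
by apply/allP.
Qed.

Lemma RS_sum_le f h : (forall t, D t -> f t <= h t) ->
  \forall sX \near RSF, RS_sum a b g f sX.1 sX.2 <= RS_sum a b g h sX.1 sX.2.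
Proof.
move=> fh; apply: filterS near_partition => -[s X] [Ps Xs] /=.
have [[ps /eqP lst] _] := Ps.
have : 0 <= RS_sum a b g (fun t => 1 * h t + (-1) * f t) s X.
  apply: RS_sum_ge0 ps (ts_partition_monotone Ps) Xs _ => u [Tu].
  rewrite lst mul1r mulN1r subr_ge0 => /andP[au ub]; apply: fh.
  by split=> //; rewrite au ltW.
by rewrite RS_sum_lin mul1r mulN1r subr_ge0.
Qed.

Lemma small_osc_bounded f e c s : {in c :: s, forall t, T t} ->
  path (fun x z => `[< small_osc T f e x z >]) c s ->
  exists M, forall u, ts_co T c (last c s) u -> `|f u| <= M.
Proof.
elim: s c => [|t s IH] c Tcs /=.
  by exists 0 => u [_ /andP[cu /(le_lt_trans cu)]]; rewrite ltxx.
case/andP => /asboolP osct oscs.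
have [|M hM] := IH t _ oscs; first by move=> x xs; apply: Tcs; rewrite in_cons xs orbT.
have Tc : T c by apply: Tcs; rewrite mem_head.
exists (Num.max M (`|f c| + e)) => u [Tu /andP[cu ul]]; rewrite le_max.
have [tu|ut] := leP t u; first by rewrite hM//; split=> //; rewrite tu.
rewrite -[f u](subrK (f c)) [X in _ || X](le_trans (ler_normD _ _)) ?orbT//.
rewrite addrC lerD2l osct//; split=> //; first by rewrite cu.
by rewrite lexx (le_lt_trans cu).
Qed.

(** All sums over refinements of a partition with small oscillation are close to
    one of its own sums, so the sums satisfy Cauchy's criterion along the
    refinement filter. *)
Lemma small_osc_integrable f : (forall e, 0 < e -> exists2 s,
    ts_partition T a b s & path (fun x z => `[< small_osc T f e x z >]) a s) ->
  RS_delta_integrable T a b g f.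
Proof.
move=> oscf; suff /cauchy_cvg : cauchy (RS_sum a b g f sX.1 sX.2 @[sX --> RSF]).
  move=> cf; exists (lim (RS_sum a b g f sX.1 sX.2 @[sX --> RSF])).
  apply/is_RS_delta_integralP; split=> //.
  have [s [[ps /eqP ls] Ds] oscs] := oscf _ ltr01.
  have [|M hM] := small_osc_bounded _ oscs; first by move=> x /Ds[].
  exists (Num.max M `|f b|); split; first exact: num_real.
  move=> K MK u [Tu /andP[au ub]]; rewrite /= (le_trans _ (ltW MK))// le_max.
  move: ub; rewrite le_eqVlt => /predU1P[->|ub]; first by rewrite lexx orbT.
  by rewrite hM// ls; split=> //; rewrite au.
apply: cauchy_exP => e e0.
have gab : 0 <= g b - g a.
  by rewrite subr_ge0 g_nd ?ltW//; [exact: ts_cc_left|exact: ts_cc_right].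
(* The summand 1 covers the case g a = g b. *)
have k0 : 0 < e / (g b - g a + 1) by rewrite divr_gt0// ltr_wpDl.
have [s0 Ps0 osc0] := oscf _ k0.
have sel0 := selection_left Ps0.
exists (RS_sum a b g f s0 (nth b (a :: s0))); exists s0 => // -[s X] [Ps rs Xs].
have [[p0 /eqP l0] _] := Ps0; have [[ps /eqP ls] _] := Ps.
have sub : {subset s0 <= s}.
  move=> x xs0; have : x \in a :: s by rewrite rs// in_cons xs0 orbT.
  rewrite in_cons => /predU1P[xa|//].
  by have := allP (lt_path_min p0) _ xs0; rewrite xa ltxx.
rewrite /= /ball/= distrC.
apply: le_lt_trans (RS_sum_refine p0 ps sub _ _ osc0 Xs sel0) _.
- by rewrite ls l0.
- exact: ts_partition_monotone.
rewrite ls mulrAC ltr_pdivrMr ?ltr_wpDl// ltr_pM2l//.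
by rewrite ltrDl.
Qed.

End Integral.

(** * Rd-continuous functions have partitions with small oscillation *)

Section RegulatedFunctions.
Context {R : realType} (T : set R) (a b : R).
Hypotheses (cT : closed T) (Ta : T a) (Tb : T b) (ab : a < b).

Local Notation D := (ts_cc T a b).
Implicit Types (f : R -> R) (s : seq R) (t : R).

(** The Cauchy condition along [G].  It needs no limit value, which p * F(y)
    does not provide explicitly, and it is what partitions are built from. *)
Definition vanishing_osc (G : set_system R) f : Prop := forall e, 0 < e ->
  exists2 U, G U & forall u v, U u -> U v -> `|f u - f v| <= e.

(** The left filter excludes t and the right one contains it, matching the
    half-open intervals of a partition.  At a left-scattered t the former is
    improper, at a right-scattered t the latter is principal at t; this spares
    any case distinction between dense and scattered points. *)
Definition ts_left t : set_system R := within D t^'-.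

Definition ts_right t : set_system R := within D (within [set u | t <= u] (nbhs t)).

Lemma ts_leftE t U : ts_left t U = (\forall u \near t, u < t -> D u -> U u).
Proof. by []. Qed.

Lemma ts_rightE t U : ts_right t U = (\forall u \near t, t <= u -> D u -> U u).
Proof. by []. Qed.

Lemma cvg_vanishing_osc (G : set_system R) f (l : R) : Filter G ->
  f @ G --> l -> vanishing_osc G f.
Proof.
move=> FG fl e e0; have e20 : 0 < e / 2 by rewrite divr_gt0.
exists [set u | `|l - f u| < e / 2]; first by move/cvgrPdist_lt: fl; exact.
move=> u v /=; rewrite !ltr_norml => /andP[? ?] /andP[? ?].
by rewrite ler_norml; apply/andP; split; lra.
Qed.

Lemma rd_continuous_left f t : D t -> rd_continuous D f ->
  exists l : R, f @ ts_left t --> l.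
Proof.
move=> Dt [_ fleft]; have [/fleft//|nld] := pselect (left_dense D t).
suff G0 : ts_left t set0 by exists 0 => U _; apply: filterS G0.
rewrite ts_leftE.
have [[s Ds st]|ns] := pselect (exists2 s, D s & s < t); last first.
  by apply/nbhs_ballP; exists 1 => //= u _ ut Du; apply: ns; exists u.
have ub : ubound [set s | D s /\ s < t] t by move=> x [_ /ltW].
have hs : has_sup [set s | D s /\ s < t] by split; [exists s|exists t].
have st' : sup [set s | D s /\ s < t] < t.
  rewrite lt_neqAle ge_sup//; last by case: hs.
  by rewrite andbT; apply/eqP => E; apply: nld; split=> //; exists s.
apply: filterS (lt_nbhsr st') => u + ut Du.
by rewrite ltNge; apply/negP/negPn; apply: ub_le_sup => //; exists t.
Qed.

Lemma rd_continuous_right f t : D t -> rd_continuous D f ->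
  f @ ts_right t --> f t.
Proof.
move=> Dt [fright _]; have [/fright h|nrd] := pselect (right_dense D t).
  move=> U /h hU; suff : ts_right t (f @^-1` U) by [].
  rewrite ts_rightE; have : \forall u \near t, D u -> U (f u) by exact: hU.
  by apply: filterS => u + tu Du; exact.
have G1 : ts_right t [set t].
  rewrite ts_rightE.
  have [[s Ds ts]|ns] := pselect (exists2 s, D s & t < s); last first.
    apply/nbhs_ballP; exists 1 => //= u _ tu Du; apply/eqP; rewrite eq_le tu andbT leNgt.
    by apply/negP => ?; apply: ns; exists u.
  have lb : lbound [set s | D s /\ t < s] t by move=> x [_ /ltW].
  have hi : has_inf [set s | D s /\ t < s] by split; [exists s|exists t].
  have ti : t < inf [set s | D s /\ t < s].
    rewrite lt_neqAle lb_le_inf//; last by case: hi.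
    by rewrite andbT; apply/eqP => E; apply: nrd; split=> //; exists s.
  apply: filterS (lt_nbhsl ti) => u ui tu Du; apply/eqP.
  rewrite eq_le [t <= u]tu andbT leNgt; apply/negP => ltu.
  move: ui; rewrite ltNge => /negP; apply; apply: ge_inf => //.
  by case: hi.
move=> U Ut; suff : ts_right t (f @^-1` U) by [].
by apply: filterS G1 => u ->; exact: nbhs_singleton Ut.
Qed.

(** Let m be the supremum of the points c such that [a,c]_T has a partition with
    small oscillation.  The left condition at m shows that m is itself such a
    point.  If m < b, the right condition produces a larger one: a point of D
    close to m when there is one, and otherwise the successor of m in D, in
    which case [m, successor)_T is the singleton m. *)
Lemma osc_partition f :
  (forall t, D t -> vanishing_osc (ts_left t) f /\ vanishing_osc (ts_right t) f) ->
  forall e, 0 < e -> exists2 s, ts_partition T a b s &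
    path (fun x z => `[< small_osc T f e x z >]) a s.
Proof.
move=> oscf e e0.
pose S := [set c | D c /\ exists s, [/\ path <%R a s, last a s = c,
  {in a :: s, forall t, D t} & path (fun x z => `[< small_osc T f e x z >]) a s]].
have S_extend c d : S c -> D d -> c < d -> small_osc T f e c d -> S d.
  move=> [Dc [s [ps ls Ds os]]] Dd cd ocd; split=> //; exists (rcons s d).
  rewrite !rcons_path last_rcons ls ps os cd; split=> //.
    by move=> x; rewrite -rcons_cons mem_rcons in_cons => /predU1P[->//|/Ds].
  by apply/asboolP.
have Da : D a by exact: ts_cc_left.
have Sa : S a by split=> //; exists [::]; split=> // x; rewrite inE => /eqP->.
have Sb : ubound S b by move=> c [[_ /andP[]]].
have hS : has_sup S by split; [exists a|exists b].
have cD : closed D.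
  rewrite (_ : D = T `&` [set` `[a, b]]); last first.
    by apply/seteqP; split=> x /=; rewrite in_itv.
  by apply: closedI => //; exact: itv_closed.
pose m := sup S.
have Dm : D m.
  rewrite ((closure_id D).1 cD).
  apply: (@closureS _ S D); first by move=> x [].
  by apply: closure_sup; [exists a|exists b].
have Sm : S m.
  have [/(_ _ e0)[U + oU] _] := oscf _ Dm.
  rewrite ts_leftE => /nbhs_ballP[d /= d0 hd].
  have [c Sc mc] := sup_adherent d0 hS.
  have := ub_le_sup hS.2 Sc; rewrite -/m le_eqVlt => /predU1P[<-//|cm].
  apply: (S_extend _ _ Sc) => // u v [Tu /andP[cu um]] [Tv /andP[cv vm]].
  have [[Tc /andP[ac cb]] _] := Sc; have [_ /andP[am mb]] := Dm.
  apply: oU; apply: hd; rewrite /ball/=.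
  - by rewrite ltr_norml; apply/andP; split; rewrite -/m in mc *; lra.
  - done.
  - by split=> //; apply/andP; split; lra.
  - by rewrite ltr_norml; apply/andP; split; rewrite -/m in mc *; lra.
  - done.
  - by split=> //; apply/andP; split; lra.
suff bm : b = m.
  case: Sm => _ [s [ps ls Ds os]]; exists s => //; split=> //.
  by split=> //; rewrite ls bm.
apply/eqP; rewrite eq_le [m <= b]ge_sup//; last by exists a.
rewrite andbT leNgt; apply/negP => mb.
have Smax d : S d -> ~~ (m < d) by move=> Sd; rewrite -leNgt ub_le_sup//; case: hS.
have [_ /(_ _ e0)[U + oU]] := oscf _ Dm.
rewrite ts_rightE => /nbhs_ballP[d /= d0 hd].
have [[z Dz /andP[mz zmd]]|nz] := pselect (exists2 z, D z & m < z < m + d).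
  suff /Smax : S z by rewrite mz.
  apply: (S_extend _ _ Sm) => // u v [Tu /andP[cu um]] [Tv /andP[cv vm]].
  have [_ /andP[am _]] := Dm; have [_ /andP[_ zb]] := Dz.
  apply: oU; apply: hd; rewrite /ball/=.
  - by rewrite ltr_norml; apply/andP; split; lra.
  - done.
  - by split=> //; apply/andP; split; lra.
  - by rewrite ltr_norml; apply/andP; split; lra.
  - done.
  - by split=> //; apply/andP; split; lra.
(* Here m is right-scattered, and [inf E] is its successor. *)
pose E := [set x | D x /\ m < x].
have Eb : E b by split=> //; exact: ts_cc_right.
have lbE : lbound E (m + d).
  by move=> x [Dx mx]; rewrite leNgt; apply/negP => xmd; apply: nz; exists x => //;
    rewrite mx.
have iE : m + d <= inf E by apply: lb_le_inf => //; exists b.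
have hE : has_lbound E by exists (m + d).
have Di : D (inf E).
  rewrite ((closure_id D).1 cD); apply: (@closureS _ E D); first by move=> x [].
  move=> V /nbhs_ballP[r /= r0 hV].
  have [x Ex xr] := inf_adherent r0 (conj (ex_intro _ b Eb) hE).
  exists x; split=> //; apply: hV; rewrite /ball/= ltr_norml.
  by have := ge_inf hE Ex; move=> ?; apply/andP; split; lra.
suff /Smax : S (inf E) by move=> /negP; apply; lra.
apply: (S_extend _ _ Sm) => //; first by lra.
have onlym u : ts_co T m (inf E) u -> u = m.
  move=> [Tu /andP[mu ui]]; apply/eqP; rewrite eq_le mu andbT leNgt.
  apply/negP => mu'; suff : E u by move=> /(ge_inf hE); rewrite leNgt ui.
  have [_ /andP[am _]] := Dm; have [_ /andP[_ ib]] := Di.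
  by split=> //; split=> //; apply/andP; split; lra.
by move=> u v /onlym-> /onlym->; rewrite subrr normr0 ltW.
Qed.

End RegulatedFunctions.

(** * Jensen's inequality for Riemann-Stieltjes sums *)

Section Convexity.
Context {R : realType}.
Implicit Types (I : interval R) (F : R -> R).

(** Weighted form of two-point convexity without division, so that it also
    covers zero weights. *)
Lemma convex_combination I F w1 w2 x1 x2 :
  @convex_function R R^o [set` I] F -> 0 <= w1 -> 0 <= w2 ->
  x1 \in I -> x2 \in I ->
  exists2 z, z \in I &
    w1 * x1 + w2 * x2 = (w1 + w2) * z /\ (w1 + w2) * F z <= w1 * F x1 + w2 * F x2.
Proof.
move=> cF w1_ge0 w2_ge0 x1I x2I.
have [w0|w0] := eqVneq (w1 + w2) 0.
  have w10 : w1 = 0 by lra.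
  have w20 : w2 = 0 by lra.
  by exists x1 => //; rewrite w10 w20 addr0 !mul0r addr0.
have w_gt0 : 0 < w1 + w2 by rewrite lt_neqAle eq_sym w0 addr_ge0.
have t0 : 0 <= w1 / (w1 + w2) by rewrite divr_ge0// ltW.
have t1 : w1 / (w1 + w2) <= 1 by rewrite ler_pdivrMr// mul1r lerDl.
pose t : {i01 R} := Itv01 t0 t1.
pose r := w1 / (w1 + w2).
have tC : (w1 + w2) * (1 - r) = w2 by rewrite /r; field.
have tw : (w1 + w2) * r = w1 by rewrite /r; field.
have rconv u v : (w1 + w2) * (r * u + (1 - r) * v) = w1 * u + w2 * v.
  by transitivity ((w1 + w2) * r * u + (w1 + w2) * (1 - r) * v);
    [ring|rewrite tw tC].
exists (r * x1 + (1 - r) * x2).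
  have iI := @interval_is_interval _ I.
  by have [x12|/ltW x21] := leP x1 x2; [apply: (iI x1 x2)|apply: (iI x2 x1)] => //;
    apply/andP; split; rewrite -(ler_pM2l w_gt0) rconv; nra.
split=> //; rewrite -rconv ler_pM2l//.
exact: (cF t x1 x2 (mem_set x1I) (mem_set x2I)).
Qed.

(** Stating the mean as a point [z] with product equal to the weighted sum,
    rather than as a quotient, lets the induction pass through partial sums of
    total weight zero; [x0] is the mean of the empty sum. *)
Lemma RS_sum_jensen (T : set R) I F a b (g p y : R -> R) s X x0 :
    @convex_function R R^o [set` I] F -> x0 \in I ->
    path <%R a s -> path (fun u v => g u <= g v) a s -> selection T a b s X ->
    (forall u, ts_co T a (last a s) u -> 0 <= p u /\ y u \in I) ->
  exists2 z, z \in I &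
    [/\ 0 <= RS_sum a b g p s X,
        RS_sum a b g (fun t => p t * y t) s X = RS_sum a b g p s X * z &
        RS_sum a b g p s X * F z <= RS_sum a b g (fun t => p t * F (y t)) s X].
Proof.
move=> cF x0I; elim: s a X => [|t s IH] a X.
  by exists x0 => //; rewrite !RS_sum_nil !mul0r.
rewrite !RS_sum_cons/=.
move=> /andP[at_ ts] /andP[gat gs] /selection_cons[[TX /andP[aX Xt]] Xs] pyI.
have tl : t <= last t s by rewrite mem_le_last// mem_head.
have [|z zI [P0 Qz Hz]] := IH t _ ts gs Xs.
  move=> u [Tu /andP[tu ul]]; apply: pyI.
  by split=> //; rewrite (le_trans (ltW at_)).
have [p0 y0I] : 0 <= p (X 0%N) /\ y (X 0%N) \in I.
  by apply: pyI; split=> //; rewrite aX (lt_le_trans Xt).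
have w0 : 0 <= p (X 0%N) * (g t - g a) by rewrite mulr_ge0// subr_ge0.
have [v vI [h1 h2]] := convex_combination cF w0 P0 y0I zI.
exists v => //; split; first exact: addr_ge0.
  by rewrite -h1 Qz; ring.
by apply: le_trans h2 _; rewrite [X in _ <= X + _]mulrAC lerD2l.
Qed.

End Convexity.

(** * Oscillation of p * F(y) from a bounded weighted subgradient *)

(** [k] stands for p * phi(y), which is real-valued and bounded even where [F]
    or phi(y) is not. *)
Section WeightedComposition.
Context {R : realType} (D : set R) (I : interval R) (F y p k : R -> R) (B : R).
Hypotheses (yI : forall t, D t -> y t \in I) (p_ge0 : forall t, D t -> 0 <= p t).
Hypothesis subgrad : forall t x, D t -> x \in I ->
  p t * F (y t) + (x - y t) * k t <= p t * F x.
Hypothesis kB : forall t, D t -> `|k t| <= B.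

Let subgrad_increment u v : D u -> D v ->
  (y v - y u) * k u <= p u * (F (y v) - F (y u)).
Proof. by move=> Du Dv; have := subgrad Du (yI Dv); lra. Qed.

Let increment_bound (c d u v : R) : 0 <= c -> D u -> `|y u - y v| <= d ->
  d * B <= c -> - c <= (y v - y u) * k u.
Proof.
move=> c0 /kB ku yuv dB; have : `|(y v - y u) * k u| <= c.
  by rewrite normrM distrC (le_trans _ dB)// ler_pM.
by rewrite ler_norml => /andP[].
Qed.

Let div_succ_mul (x z : R) : 0 <= x -> 0 <= z -> x / (z + 1) * z <= x.
Proof.
move=> x0 z0; rewrite mulrAC ler_pdivrMr ?ltr_wpDl//.
by rewrite ler_wpM2l// lerDl.
Qed.

Section AlongFilter.
Variables (G : set_system R) (l : R).
Hypotheses (FG : Filter G) (GD : G D) (yl : y @ G --> l).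
Hypothesis pick : forall W, G W -> exists u, [/\ W u, D u & 0 < p u].

Let B_ge0 : 0 <= B.
Proof. by have [u [_ /kB + _]] := pick GD; exact: le_trans. Qed.

Let B1_gt0 : 0 < B + 1. Proof. exact: ltr_wpDl. Qed.

(** Take c with p(c) > 0 and y(c) close to the nearby values of [y].  The weighted subgradient
    at the current point bounds p * F(y) from above by p * F(y c) plus a small
    term controlled by [B]; the one at c bounds F(y) from below, hence p * F(y)
    from below by a multiple of [p].  Both bounds are small because [p] is. *)
Lemma weighted_osc0 : p @ G --> 0 -> vanishing_osc G (fun t => p t * F (y t)).
Proof.
move=> p0 e e0.
have d0 : 0 < e / 8 / (B + 1) by rewrite !divr_gt0.
have [U GU oy] := cvg_vanishing_osc FG yl d0.
have [c [Uc Dc pc]] := pick GU.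
have e8 : 0 <= e / 8 by rewrite ltW// divr_gt0.
have dB : e / 8 / (B + 1) * B <= e / 8 by exact: div_succ_mul.
(* The coefficient of [p u] is at most N in both the upper and the lower
   estimate of [p u * F (y u)]; the second summand comes from the lower one. *)
pose N := `|F (y c)| + e / 8 / p c.
have N0 : 0 <= N by rewrite addr_ge0// !divr_ge0// ltW.
have n0 : 0 < e / 4 / (N + 1) by rewrite !divr_gt0// ltr_wpDl.
have pN : e / 4 / (N + 1) * N <= e / 4 by rewrite div_succ_mul// ltW// divr_gt0.
have Gp : G [set u | `|p u| < e / 4 / (N + 1)].
  have /cvgrPdist_lt/(_ _ n0) := p0; apply: filterS => u /=.
  by rewrite sub0r normrN.
have bnd u : U u -> D u -> `|p u| < e / 4 / (N + 1) -> `|p u * F (y u)| <= e / 2.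
  move=> Uu Du; rewrite ger0_norm ?p_ge0// => /ltW pu.
  have puN : p u * N <= e / 4 by apply: le_trans pN; rewrite ler_wpM2r.
  have pu0 := p_ge0 Du.
  have h1 := subgrad_increment Du Dc.
  have h2 := increment_bound e8 Du (oy _ _ Uu Uc) dB.
  have h3 := subgrad_increment Dc Du.
  have h4 := increment_bound e8 Dc (oy _ _ Uc Uu) dB.
  have h5 : - (e / 8 / p c) <= F (y u) - F (y c).
    by rewrite -mulNr ler_pdivrMr// [_ * p c]mulrC; lra.
  have := ler_wpM2l pu0 h5.
  have := ler_wpM2l pu0 (ler_norm (F (y c))).
  have := ler_wpM2l pu0 (lerNnormlW (lexx `|F (y c)|)).
  move: puN; rewrite /N ler_norml mulrDr => *; apply/andP; split; lra.
exists ((U `&` D) `&` [set u | `|p u| < e / 4 / (N + 1)]).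
  by do 2?apply: filterI.
move=> u v [[Uu Du] pu] [[Uv Dv] pv].
have := bnd _ Uu Du pu; have := bnd _ Uv Dv pv.
by rewrite !ler_norml => /andP[? ?] /andP[? ?]; apply/andP; split; lra.
Qed.

(** Near the limit, [p] is bounded away from 0, so dividing by it turns the bound
    on [k] into one on the subgradient of [F]; this makes F(y) bounded.  Then
    p u F(y u) - p v F(y v) splits into (p u - p v) F(y v) and
    p u (F(y u) - F(y v)), the latter at most B |y u - y v|. *)
Lemma weighted_osc_neq0 (q : R) : q != 0 -> p @ G --> q ->
  vanishing_osc G (fun t => p t * F (y t)).
Proof.
move=> q0 pq e e0.
have Gq : G [set u | `|q - p u| < `|q| / 2].
  by have /cvgrPdist_lt := pq; apply; rewrite divr_gt0// normr_gt0.
have qp : 0 < q.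
  have [u [/= qpu _ pu]] := pick Gq.
  move: q0; rewrite neq_lt => /orP[qn|//]; move: qpu.
  by rewrite (ltr0_norm qn) ltr_norml => /andP[? ?]; lra.
have [U GU oy] := cvg_vanishing_osc FG yl ltr01.
pose W := (U `&` D) `&` [set u | `|q - p u| < `|q| / 2].
have GW : G W by do 2?apply: filterI.
have Wp u : W u -> q / 2 < p u.
  by case=> _ /=; rewrite (gtr0_norm qp) ltr_norml => /andP[? ?]; lra.
have [c [Wc Dc _]] := pick GW.
pose M := `|F (y c)| + 2 * B / q.
have Mq : 2 * B / q * q = 2 * B by rewrite divfK// gt_eqF.
have Bq0 : 0 <= 2 * B / q by rewrite divr_ge0 ?mulr_ge0// ltW.
have M0 : 0 <= M by rewrite addr_ge0.
have B1 : 1 * B <= B by rewrite mul1r.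
have bnd1 u v : W u -> W v -> F (y u) - F (y v) <= 2 * B / q.
  move=> Wu Wv; have [[Uu Du] _] := Wu; have [[Uv Dv] _] := Wv.
  have h1 := subgrad_increment Du Dv.
  have h2 := increment_bound B_ge0 Du (oy _ _ Uu Uv) B1.
  rewrite leNgt; apply/negP => lt_x; set x := F (y u) - F (y v) in lt_x.
  have x0 : 0 <= x by rewrite (le_trans Bq0)// ltW.
  have h3 := ler_wpM2r x0 (ltW (Wp _ Wu)).
  have h4 : 2 * B < x * q by rewrite -Mq ltr_pM2r.
  have h5 : p u * (F (y v) - F (y u)) = - (p u * x) by rewrite -mulrN opprB.
  by rewrite h5 in h1; lra.
have bnd u : W u -> `|F (y u)| <= M.
  move=> Wu; have := bnd1 _ _ Wu Wc; have := bnd1 _ _ Wc Wu.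
  have := ler_norm (F (y c)); have := lerNnormlW (lexx `|F (y c)|).
  by rewrite /M ler_norml => *; apply/andP; split; lra.
have e2 : 0 <= e / 2 by rewrite ltW// divr_gt0.
have d0 : 0 < e / 2 / (B + 1) by rewrite !divr_gt0.
have [V GV oyV] := cvg_vanishing_osc FG yl d0.
have n0 : 0 < e / 2 / (M + 1) by rewrite !divr_gt0// ltr_wpDl.
have [Z GZ op] := cvg_vanishing_osc FG pq n0.
have half u v : W u -> W v -> V u -> V v -> Z u -> Z v ->
    p u * F (y u) - p v * F (y v) <= e.
  move=> Wu Wv Vu Vv Zu Zv; have [[_ Du] _] := Wu; have [[_ Dv] _] := Wv.
  have := subgrad_increment Du Dv.
  have := increment_bound e2 Du (oyV _ _ Vu Vv) (div_succ_mul e2 B_ge0).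
  have : (p u - p v) * F (y v) <= e / 2.
    apply: le_trans (ler_norm _) _; rewrite normrM.
    apply: le_trans (div_succ_mul e2 M0).
    by rewrite ler_pM//; [exact: op|exact: bnd].
  lra.
exists ((W `&` V) `&` Z); first by do 2?apply: filterI.
move=> u v [[Wu Vu] Zu] [[Wv Vv] Zv].
have := half _ _ Wu Wv Vu Vv Zu Zv; have := half _ _ Wv Wu Vv Vu Zv Zu.
by move=> ? ?; rewrite ler_norml; apply/andP; split; lra.
Qed.

End AlongFilter.

Lemma weighted_convex_osc (G : set_system R) (q l : R) : Filter G ->
  G D -> p @ G --> q -> y @ G --> l ->
  vanishing_osc G (fun t => p t * F (y t)).
Proof.
move=> FG GD pq yl.
have [[U GU p0]|np0] := pselect (exists2 U, G U & forall u, U u -> p u = 0).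
  move=> e e0; exists U => // u v /p0-> /p0->.
  by rewrite !mul0r subrr normr0 ltW.
have pick W : G W -> exists u, [/\ W u, D u & 0 < p u].
  move=> GW; apply: contrapT => nW; apply: np0.
  exists (W `&` D); first exact: filterI.
  move=> u [Wu Du]; apply/eqP/negPn/negP => pu; apply: nW; exists u.
  by split=> //; rewrite lt_neqAle eq_sym pu p_ge0.
have [q0|q0] := eqVneq q 0; last exact: (weighted_osc_neq0 FG GD yl pick q0).
by apply: (weighted_osc0 FG GD yl pick); rewrite -q0.
Qed.

End WeightedComposition.

(** * The integral inequalities *)

Lemma cvg_near_le {R : realType} {S : Type} (G : set_system S)
    {FG : ProperFilter G} (u v : S -> R) (l l' : R) :
  u @ G --> l -> v @ G --> l' -> (\forall x \near G, u x <= v x) -> l <= l'.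
Proof.
move=> ul vl uv; rewrite -subr_ge0; apply: cvgr_to_ge (cvgB vl ul) _.
by apply: filterS uv => x; rewrite -subr_ge0.
Qed.

(** If [phi u] is infinite, finiteness of the product forces w = 0, and both sides
    vanish; otherwise this is the subgradient inequality multiplied by [w]. *)
Lemma fine_mulr_subgradient {R : realType} (I : interval R) (F : R -> R)
    (phi : R -> \bar R) (w u x : R) :
  subdifferential I F phi -> 0 <= w -> (w%:E * phi u)%E \is a fin_num ->
  u \in I -> x \in I ->
  w * F u + (x - u) * fine (w%:E * phi u)%E <= w * F x.
Proof.
move=> [_ sub]; rewrite le_eqVlt => /predU1P[<- _ _ _|w0 + uI xI].
  by rewrite mul0e fine0 !mul0r mulr0 addr0 lexx.
have := sub x u xI uI; case: (phi u) => [r| |].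
- rewrite -EFinM -EFinD lee_fin => h _ /=.
  by rewrite mulrCA -mulrDr ler_pM2l.
- by rewrite (@gt0_muley _ w%:E)// lte_fin.
- by rewrite (@gt0_muleNy _ w%:E)// lte_fin.
Qed.

Lemma fine_mulr_mulr {R : realType} (w u : R) (z : \bar R) :
  (w%:E * z)%E \is a fin_num ->
  fine (w%:E * u%:E * z)%E = u * fine (w%:E * z)%E.
Proof.
by move=> /fineK wz; rewrite (muleC w%:E) -muleA -wz.
Qed.

Theorem corollary14 (R : realType) (T : set R) (a b : R) (I : interval R)
    (F y p g : R -> R) (phi : R -> \bar R)
    (hT : time_scale T) (Ta : T a) (Tb : T b) (ab : a < b)
    (Fcont : {within [set` I], continuous F})
    (Fconvex : @convex_function R R^o [set` I] F)
    (yI : forall t, ts_cc T a b t -> y t \in I)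
    (pI : forall t, ts_cc T a b t -> p t \in I)
    (gI : forall t, ts_cc T a b t -> g t \in I)
    (yrd : rd_continuous (ts_cc T a b) y)
    (prd : rd_continuous (ts_cc T a b) p)
    (p_ge0 : forall t, ts_cc T a b t -> 0 <= p t)
    (g_nd : forall s t, ts_cc T a b s -> ts_cc T a b t -> s <= t -> g s <= g t)
    (phiF : subdifferential I F phi) :
  let integrable := RS_delta_integrable T a b g in
  let integral := RS_delta_integral T a b g in
  let integrable_ext := RS_delta_integrable_ext T a b g in
  let integral_ext := RS_delta_integral_ext T a b g in
  let A := integral p in
  let py := fun t => p t * y t in
  let pFy := fun t => p t * F (y t) in
  let pyphi := fun t => ((p t)%:E * (y t)%:E * phi (y t))%E in
  let pphi := fun t => ((p t)%:E * phi (y t))%E in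
  0 < A ->
  integrable_ext pyphi ->
  integrable_ext pphi ->
  A^-1 * integral py \in I ->
  [/\ [/\ integrable p, integrable py & integrable pFy],
      0 <= A^-1 * integral pFy - F (A^-1 * integral py) &
      A^-1 * integral pFy - F (A^-1 * integral py)
        <= A^-1 * (integral_ext pyphi
                   - A^-1 * integral py * integral_ext pphi)].
Proof.
move=> integrable integral integrable_ext integral_ext A py pFy pyphi pphi.
move=> A0 [_ iypk] [fink ik] mI.
set m := A^-1 * integral py in mI *.
pose D := ts_cc T a b.
pose k t := fine (pphi t).
have subgrad t x : D t -> x \in I ->
    p t * F (y t) + (x - y t) * k t <= p t * F x.
  move=> Dt xI.
  exact: (fine_mulr_subgradient phiF (p_ge0 t Dt) (fink t Dt) (yI t Dt) xI).
have [B kB] : exists B, forall t, D t -> `|k t| <= B.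
  have [l [/ex_strict_bound_gt0[B _ kB] _]] := ik.
  by exists B => t /kB/ltW.
have cT : closed T by case: hT.
have FF := RS_filter_proper Ta Tb ab.
have integrable_of f : (forall t, D t ->
    vanishing_osc (ts_left T a b t) f /\ vanishing_osc (ts_right T a b t) f) ->
    integrable f.
  move=> oscf; apply: (small_osc_integrable Ta Tb ab g_nd) => e e0.
  exact: (osc_partition cT Ta Tb ab oscf).
have ip : integrable p.
  apply: integrable_of => t Dt; have [l pl] := rd_continuous_left Dt prd.
  by split; [exact: cvg_vanishing_osc pl|
             exact: cvg_vanishing_osc (rd_continuous_right Dt prd)].
have ipy : integrable py.
  apply: integrable_of => t Dt; have [l pl] := rd_continuous_left Dt prd.
  have [l' yl] := rd_continuous_left Dt yrd.
  split; first exact: cvg_vanishing_osc (cvgM pl yl).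
  exact: cvg_vanishing_osc (cvgM (rd_continuous_right Dt prd) (rd_continuous_right Dt yrd)).
have ipFy : integrable pFy.
  apply: integrable_of => t Dt; have [l pl] := rd_continuous_left Dt prd.
  have [l' yl] := rd_continuous_left Dt yrd.
  split.
    by apply: (weighted_convex_osc yI p_ge0 subgrad kB _ _ pl yl); exact: withinT.
  apply: (weighted_convex_osc yI p_ge0 subgrad kB _ _ (rd_continuous_right Dt prd)
    (rd_continuous_right Dt yrd)); exact: withinT.
have cp := RS_delta_integral_cvg Ta Tb ab ip.
have cpy := RS_delta_integral_cvg Ta Tb ab ipy.
have cpFy := RS_delta_integral_cvg Ta Tb ab ipFy.
have cpk := RS_delta_integral_cvg Ta Tb ab ik.
have cpyk := RS_delta_integral_cvg Ta Tb ab iypk.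
split=> //.
  rewrite subr_ge0.
  have near_jensen : \forall sX \near RS_filter T a b, exists2 z, z \in I &
    [/\ 0 <= RS_sum a b g p sX.1 sX.2,
        RS_sum a b g py sX.1 sX.2 = RS_sum a b g p sX.1 sX.2 * z &
        RS_sum a b g p sX.1 sX.2 * F z <= RS_sum a b g pFy sX.1 sX.2].
    apply: filterS (near_partition Ta Tb ab) => -[s X] /= [Ps Xs].
    have [[ps /eqP ls] _] := Ps.
    apply: (RS_sum_jensen Fconvex mI ps (ts_partition_monotone g_nd Ps) Xs).
    rewrite ls => u [Tu /andP[au ub]].
    have Du : D u by split=> //; rewrite au ltW.
    by split; [exact: p_ge0|exact: yI].
  have near_pos : \forall sX \near RS_filter T a b,
    0 < RS_sum a b g p sX.1 sX.2 by exact: (cvgr_gt A cp).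
  pose mean f sX := (RS_sum a b g p sX.1 sX.2)^-1 * RS_sum a b g f sX.1 sX.2.
  have cmean f l : RS_sum a b g f sX.1 sX.2 @[sX --> RS_filter T a b] --> l ->
      mean f @ RS_filter T a b --> A^-1 * l.
    by move=> cf; apply: cvgM cf; apply: cvgV => //; rewrite gt_eqF.
  (* Jensen's inequality for the sums also shows that their mean lies in [I],
     where [F] is continuous. *)
  have cF : F (mean py sX) @[sX --> RS_filter T a b] --> F m.
    have /subspace_continuousP/(_ m mI) := Fcont; apply: cvg_comp.
    move=> U Um; have := cmean _ _ cpy _ Um; apply: filterS3 near_jensen near_pos.
    move=> sX [z zI [_ Q _]] P0; apply.
    by rewrite /mean Q mulKf// gt_eqF.
  have le_mean : \forall sX \near RS_filter T a b, F (mean py sX) <= mean pFy sX.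
    apply: filterS2 near_jensen near_pos => sX [z zI [_ Q H]] P0.
    by rewrite /mean Q mulKf ?gt_eqF// ler_pdivlMl.
  exact: (cvg_near_le cF (cmean _ _ cpFy) le_mean).
have cR : (RS_sum a b g (fine \o pyphi) sX.1 sX.2
      - m * RS_sum a b g (fine \o pphi) sX.1 sX.2
      + F m * RS_sum a b g p sX.1 sX.2) @[sX --> RS_filter T a b] -->
    integral_ext pyphi - m * integral_ext pphi + F m * A.
  apply: cvgD; last exact: cvgM (cvg_cst _) cp.
  by apply: cvgB => //; exact: cvgM (cvg_cst _) cpk.
have upper : integral pFy <=
    integral_ext pyphi - m * integral_ext pphi + F m * A.
  apply: (cvg_near_le cpFy cR).
  (* The pointwise upper bound, in the shape to which [RS_sum_lin] applies twice. *)
  pose h t := 1 * (1 * fine (pyphi t) + (- m) * k t) + F m * p t.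
  have pFyh t : D t -> pFy t <= h t.
    move=> Dt; rewrite /h /pyphi fine_mulr_mulr; last exact: fink Dt.
    by have := subgrad _ _ Dt mI; rewrite /pFy /k /pphi; lra.
  apply: filterS (RS_sum_le Ta Tb ab g_nd pFyh) => sX.
  by rewrite /h !RS_sum_lin !mul1r mulNr.
by rewrite lerBlDr -(ler_pM2l A0) mulrDr !mulVKf ?gt_eqF// [A * _]mulrC.
Qed.
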